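(* Let $R=\{(0,0),(0,1),(0,2),(1,0),(2,0)\}$. Then $(123,R)\sim_d(132,R)$.
   Context: $S_n$ denotes the set of permutations of $[n]=\{1,\dots,n\}$, written $\pi=\pi_1\cdots\pi_n$. A mesh pattern of length $k$ is a pair $(\tau,R)$ with $\tau\in S_k$ and $R\subseteq\{0,1,\dots,k\}^2$ (the shaded boxes; box $(a,b)$ is the unit square $[a,a+1]\times[b,b+1]$ in the diagram of $\tau$). An occurrence of $(\tau,R)$ in $\pi\in S_n$ is a choice of indices $i_1<\dots<i_k$ such that $\pi_{i_1}\cdots\pi_{i_k}$ is order-isomorphic to $\tau$ and, with $i_0=0$, $i_{k+1}=n+1$, $v_1<\dots<v_k$ the values $\pi_{i_1},\dots,\pi_{i_k}$ sorted increasingly, $v_0=0$, $v_{k+1}=n+1$, for every $(a,b)\in R$ there is no index $m$ with $i_a<m<i_{a+1}$ and $v_b<\pi_m<v_{b+1}$. Mesh patterns $p,q$ are equidistributed, $p\sim_d q$, if for all $n,\ell\ge0$ the number of $\pi\in S_n$ with exactly $\ell$ occurrences of $p$ equals the number with exactly $\ell$ occurrences of $q$. *)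

(* Defs.v *)
From mathcomp Require Import all_boot all_fingroup.

Set Implicit Arguments.
Unset Strict Implicit.
Unset Printing Implicit Defensive.

(* Positions and values of a permutation 'S_n are 0-based ('I_n); they are
   shifted by one below, so that 0 and n.+1 can serve as the boundary lines of
   the diagram. *)

Definition mesh_pattern (k : nat) : Type :=
  ('S_k * {set 'I_k.+1 * 'I_k.+1})%type.

Section Occurrences.

Variables (k n : nat).

(* 0, i_1, ..., i_k, n+1 *)
Definition index_lines (f : {ffun 'I_k -> 'I_n}) : seq nat :=
  0 :: rcons [seq (f j).+1 | j <- enum 'I_k] n.+1.

(* 0, v_1, ..., v_k, n+1 *)
Definition value_lines (pi : 'S_n) (f : {ffun 'I_k -> 'I_n}) : seq nat :=
  0 :: rcons (sort leq [seq (pi (f j)).+1 | j <- enum 'I_k]) n.+1.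

Definition in_box (pi : 'S_n) (f : {ffun 'I_k -> 'I_n}) (a b : nat) (m : 'I_n) :
    bool :=
  [&& nth 0 (index_lines f) a < m.+1,
      m.+1 < nth 0 (index_lines f) a.+1,
      nth 0 (value_lines pi f) b < (pi m).+1
    & (pi m).+1 < nth 0 (value_lines pi f) b.+1].

Definition is_occurrence (p : mesh_pattern k) (pi : 'S_n)
    (f : {ffun 'I_k -> 'I_n}) : bool :=
  [&& [forall a : 'I_k, forall b : 'I_k, (a < b) ==> (f a < f b)],
      [forall a : 'I_k, forall b : 'I_k, (pi (f a) < pi (f b)) == (p.1 a < p.1 b)]
    & [forall ab in p.2, forall m : 'I_n, ~~ in_box pi f ab.1 ab.2 m]].

Definition num_occurrences (p : mesh_pattern k) (pi : 'S_n) : nat :=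
  #|[set f | is_occurrence p pi f]|.

End Occurrences.

Definition equidistributed (k k' : nat) (p : mesh_pattern k)
    (q : mesh_pattern k') : Prop :=
  forall n l : nat,
    #|[set pi : 'S_n | num_occurrences p pi == l]| =
    #|[set pi : 'S_n | num_occurrences q pi == l]|.

Definition perm123 : 'S_3 := 1%g.

Definition perm132 : 'S_3 := tperm (inord 1) (inord 2).

Lemma perm123E : [seq (perm123 j).+1 | j <- enum 'I_3] = [:: 1; 2; 3].
Proof. by rewrite !enum_ordSl enum_ord0 /= !perm1. Qed.

Lemma perm132E : [seq (perm132 j).+1 | j <- enum 'I_3] = [:: 1; 3; 2].
Proof.
by rewrite !enum_ordSl enum_ord0 /= !permE /= -!val_eqE /= !inordK.
Qed.

Definition boxesR : {set 'I_4 * 'I_4} :=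
  [set ab : 'I_4 * 'I_4 | ((ab.1 : nat), (ab.2 : nat)) \in
     [:: (0, 0); (0, 1); (0, 2); (1, 0); (2, 0)]].

(* Main.v *)
(** In an occurrence of either pattern the first letter is a left-to-right
    minimum [x], and the boxes of [R] force the other two letters to lie in the
    cell of [x]: the points above and to the right of [x] that come before the
    next left-to-right minimum and lie below the value of the previous one.
    Conversely, any two points of that cell form with [x] an occurrence of 123
    or of 132, according to their relative order.  The cells are pairwise
    disjoint and contain no corner of a nonempty cell, so reversing the order of
    the points inside every cell at once leaves the cells unchanged; it is an
    involution of the symmetric group that exchanges the two kinds of
    occurrences. *)

Require Import Defs.
From mathcomp Require Import all_boot all_fingroup.
From mathcomp Require Import zify.

Set Implicit Arguments.
Unset Strict Implicit.
Unset Printing Implicit Defensive.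

(** * Order reversal of a finite set of positions *)

Definition reversal n (A : {set 'I_n}) (m : 'I_n) : 'I_n :=
  nth m (rev (enum A)) (index m (enum A)).

(** [enum A] filters the increasing enumeration of ['I_n], so it is strictly sorted. *)
Lemma nth_enum_ltn n (A : {set 'I_n}) (x : 'I_n) a b :
  a < #|A| -> b < #|A| -> (nth x (enum A) a < nth x (enum A) b) = (a < b).
Proof.
have srt : sorted (fun i j : 'I_n => i < j) (enum A).
  rewrite /enum_mem; apply: sorted_filter; first by move=> ? ? ?; apply: ltn_trans.
  by have := iota_ltn_sorted 0 n; rewrite -val_enum_ord sorted_map enumT.
rewrite cardE => lt_a lt_b; have tr : transitive (fun i j : 'I_n => i < j).
  by move=> ? ? ?; apply: ltn_trans.
have mono u v : v < size (enum A) -> u < v -> nth x (enum A) u < nth x (enum A) v.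
  move=> lt_v lt_uv.
  by apply: (sorted_ltn_nth tr x srt) => //; rewrite inE // (ltn_trans lt_uv).
case: (ltngtP a b) => [/mono->//|/mono|->]; last by rewrite ltnn.
by move/(_ lt_a) => h; rewrite ltnNge ltnW.
Qed.

Lemma reversal_in n (A : {set 'I_n}) m : m \in A -> reversal A m \in A.
Proof.
move=> Am; have lt_m : index m (enum A) < size (enum A).
  by rewrite index_mem mem_enum.
by rewrite -mem_enum -mem_rev mem_nth // size_rev.
Qed.

Lemma index_reversal n (A : {set 'I_n}) m :
  m \in A -> index (reversal A m) (enum A) = #|A| - (index m (enum A)).+1.
Proof.
move=> Am; have lt_m : index m (enum A) < size (enum A).
  by rewrite index_mem mem_enum.
rewrite /reversal nth_rev // index_uniq ?enum_uniq ?cardE //.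
by rewrite ltn_subrL (leq_ltn_trans _ lt_m).
Qed.

Lemma index_enum_ltn n (A : {set 'I_n}) m m' : m \in A -> m' \in A ->
  (index m (enum A) < index m' (enum A)) = (m < m').
Proof.
move=> Am Am'; rewrite -(@nth_enum_ltn _ A m) ?cardE ?index_mem ?mem_enum //.
by rewrite !nth_index ?mem_enum.
Qed.

Lemma reversalK n (A : {set 'I_n}) m :
  m \in A -> reversal A (reversal A m) = m.
Proof.
move=> Am; have rAm := reversal_in Am; have rrAm := reversal_in rAm.
have lt_m : index m (enum A) < #|A| by rewrite cardE index_mem mem_enum.
rewrite -[LHS](@nth_index _ m _ (enum A)) ?mem_enum //.
rewrite !index_reversal // -[RHS](@nth_index _ m _ (enum A)) ?mem_enum //.
by congr nth; lia.
Qed.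

Lemma reversal_ltn n (A : {set 'I_n}) m m' : m \in A -> m' \in A ->
  (reversal A m < reversal A m') = (m' < m).
Proof.
move=> Am Am'; rewrite -!(@index_enum_ltn _ A) ?reversal_in //.
have lt_m : index m (enum A) < #|A| by rewrite cardE index_mem mem_enum.
have lt_m' : index m' (enum A) < #|A| by rewrite cardE index_mem mem_enum.
by rewrite !index_reversal //; lia.
Qed.

(* Nonempty only if [i] is a left-to-right minimum: the third condition then
   says that [m] lies below the previous one, the fourth that it comes before
   the next one. *)
Definition cell n (pi : 'S_n) (i : 'I_n) : {set 'I_n} :=
  [set m : 'I_n | [&& i < m, pi i < pi m,
    [forall l : 'I_n, (l < i) ==> (pi m < pi l)]
  & [forall l : 'I_n, (pi l < pi i) ==> (m < l)]]].

Lemma cellP n (pi : 'S_n) (i m : 'I_n) :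
  reflect [/\ i < m, pi i < pi m, forall l : 'I_n, l < i -> pi m < pi l
            & forall l : 'I_n, pi l < pi i -> m < l] (m \in cell pi i).
Proof.
rewrite inE; apply: (iffP and4P) => -[? ? h1 h2]; split => //.
- by move=> l; apply/implyP; apply/(forallP h1).
- by move=> l; apply/implyP; apply/(forallP h2).
- by apply/forallP=> l; apply/implyP/h1.
- by apply/forallP=> l; apply/implyP/h2.
Qed.

(** * Occurrences as pairs of points in a cell *)

Lemma lift_ord3 : (lift ord0 ord0 = inord 1 :> 'I_3)
  * (lift ord0 (lift ord0 ord0) = inord 2 :> 'I_3).
Proof. by split; apply: val_inj; rewrite /= inordK. Qed.

Lemma enum_ord3 : enum 'I_3 = [:: ord0; inord 1; inord 2].
Proof. by rewrite !enum_ordSl enum_ord0 /= !lift_ord3. Qed.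

Lemma forall_ord3 (P : 'I_3 -> bool) :
  [forall a, P a] = [&& P ord0, P (inord 1) & P (inord 2)].
Proof.
apply/forallP/and3P => [|[p0 p1 p2] a]; first by split.
by have := mem_enum 'I_3 a; rewrite enum_ord3 !inE => /or3P[] /eqP->.
Qed.

Lemma forall_boxesR (P : nat -> nat -> bool) :
  [forall ab in boxesR, P ab.1 ab.2] =
  [&& P 0 0, P 0 1, P 0 2, P 1 0 & P 2 0].
Proof.
apply/forall_inP/idP => [h|/and5P[? ? ? ? ?] [a b]]; last first.
  by rewrite !inE /= => /or4P[||| /orP[]] /eqP[-> ->].
have {}h a b : a < 4 -> b < 4 ->
    (a, b) \in [:: (0, 0); (0, 1); (0, 2); (1, 0); (2, 0)] -> P a b.
  move=> lt_a lt_b; have := h (inord a, inord b).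
  by rewrite inE /= !inordK.
by rewrite !h.
Qed.

Lemma sort3 (a b c : nat) : a < b -> a < c ->
  sort leq [:: a; b; c] = [:: a; minn b c; maxn b c].
Proof.
move=> ab ac; apply: (sorted_eq leq_trans anti_leq).
- exact: (sort_sorted leq_total).
- by rewrite /=; lia.
- rewrite perm_sort perm_cons /minn /maxn; case: ltnP => // _.
  exact/permPl/(perm_catC [:: b] [:: c]).
Qed.

(** Treats both patterns at once: only the comparison of the last two letters depends on [tau]. *)
Lemma occurrence_cell n (tau : 'S_3) (pi : 'S_n) (f : {ffun 'I_3 -> 'I_n}) :
  tau ord0 = ord0 ->
  is_occurrence (tau, boxesR) pi f =
  [&& f (inord 1) \in cell pi (f ord0), f (inord 2) \in cell pi (f ord0),
      f (inord 1) < f (inord 2)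
    & (pi (f (inord 1)) < pi (f (inord 2))) == (tau (inord 1) < tau (inord 2))].
Proof.
move=> tau0; have tau_gt0 a : a != ord0 -> tau ord0 < tau a.
  by rewrite -(inj_eq (@perm_inj _ tau)) tau0 -val_eqE /=; case: (val _).
have t1 : tau ord0 < tau (inord 1) by rewrite tau_gt0 // -val_eqE /= inordK.
have t2 : tau ord0 < tau (inord 2) by rewrite tau_gt0 // -val_eqE /= inordK.
have t12 : nat_of_ord (tau (inord 1)) <> nat_of_ord (tau (inord 2)).
  by move/val_inj/perm_inj/(congr1 val); rewrite /= !inordK.
rewrite /is_occurrence !forall_ord3 /= !inordK //= !ltnn !eqxx /=.
rewrite (forall_boxesR (fun a b => [forall m, ~~ in_box pi f a b m])).
rewrite /in_box /index_lines /value_lines enum_ord3 /=.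
set x := f ord0; set y := f (inord 1); set z := f (inord 2).
move: (nat_of_ord (tau _)) (nat_of_ord (tau _)) (nat_of_ord (tau _)) t1 t2 t12 => T1 T2 T0 lt01 lt02 neq12.
move: x y z => x y z.
have pi_eq (u v : 'I_n) : pi u = pi v :> nat -> u = v :> nat.
  by move=> /val_inj/perm_inj ->.
apply/idP/and4P.
  case/and3P=> /and3P[/andP[xy xz] yz _].
  move=> /and3P[/andP[/eqP pxy /eqP pxz] /andP[_ /eqP pyz] _].
  rewrite lt01 in pxy; rewrite lt02 in pxz.
  rewrite sort3 //= => /and5P[/forallP b00 /forallP b01 /forallP b02 /forallP b10 /forallP b20].
  (* The three boxes of column 0 fill everything left of [x] below the larger of the two values; by
     injectivity [l] cannot lie on a boundary line. *)
  have low (l : 'I_n) : l < x -> maxn (pi y) (pi z) < pi l.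
    move=> lx; have := b00 l; have := b01 l; have := b02 l.
    have := @pi_eq l x; have := @pi_eq l y; have := @pi_eq l z.
    by move: lx pxy pxz xy yz; rewrite /=; lia.
  (* [low] excludes positions before [x], and boxes (1,0) and (2,0) exclude those between [x] and
     [z]. *)
  have left (l : 'I_n) : pi l < pi x -> z < l.
    move=> lx; have := low l; have := b10 l; have := b20 l.
    have : l = y :> nat -> pi l = pi y :> nat by move/val_inj->.
    have : l = x :> nat -> pi l = pi x :> nat by move/val_inj->.
    have : l = z :> nat -> pi l = pi z :> nat by move/val_inj->.
    by move: lx pxy pxz xy yz; rewrite /=; lia.
  split=> //; last by rewrite pyz.
    apply/cellP; split=> // l; [move/low|move/left]; lia.
  by apply/cellP; split=> // l /low; lia.
case=> /cellP[xy pxy ylow yleft] /cellP[xz pxz zlow zleft] yz /eqP pyz.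
rewrite sort3 //= xy xz yz pxy pxz lt01 lt02 pyz eqxx /=.
apply/andP; split; first by have := @pi_eq y z; rewrite /=; lia.
apply/and5P; split; apply/forallP=> m;
  have := ylow m; have := zlow m; have := yleft m; have := zleft m; lia.
Qed.

(** * Simultaneous reversal of the disjoint cells *)

Lemma cell_inj n (pi : 'S_n) (i i' m : 'I_n) :
  m \in cell pi i -> m \in cell pi i' -> i = i'.
Proof.
move=> /cellP[_ lt1 h1 _] /cellP[_ lt2 h2 _]; apply: val_inj.
by case: (ltngtP i i') => // [/h2 | /h1]; lia.
Qed.

(** The corner of a nonempty cell is a left-to-right minimum, whereas a point of a cell has a
    smaller value to its left. *)
Lemma cell_corner n (pi : 'S_n) (i i' m : 'I_n) :
  m \in cell pi i -> i \notin cell pi i'.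
Proof.
move=> /cellP[_ lt1 h1 _]; apply/negP=> /cellP[/h1 lt2 lt3 _ _].
by rewrite ltnNge ltnW ?(ltn_trans lt3) in lt2.
Qed.

Definition cell_reversal n (pi : 'S_n) (m : 'I_n) : 'I_n :=
  if [pick i | m \in cell pi i] is Some i then reversal (cell pi i) m else m.

Lemma cell_reversal_in n (pi : 'S_n) i m :
  m \in cell pi i -> cell_reversal pi m = reversal (cell pi i) m.
Proof.
rewrite /cell_reversal => mi; case: pickP => [j /(cell_inj mi)<- //|].
by move/(_ i); rewrite mi.
Qed.

Lemma cell_reversal_out n (pi : 'S_n) m :
  (forall i, m \notin cell pi i) -> cell_reversal pi m = m.
Proof.
rewrite /cell_reversal => out; case: pickP => // i mi.
by case/negP: (out i).
Qed.

Variant cell_spec n (pi : 'S_n) (m : 'I_n) : 'I_n -> Prop :=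
| CellIn i of m \in cell pi i & cell_reversal pi m \in cell pi i :
    cell_spec pi m (cell_reversal pi m)
| CellOut of (forall i, m \notin cell pi i) : cell_spec pi m m.

Lemma cell_reversalP n (pi : 'S_n) m : cell_spec pi m (cell_reversal pi m).
Proof.
case: (pickP (fun i => m \in cell pi i)) => [i mi | out].
  by apply: (CellIn mi); rewrite (cell_reversal_in mi) reversal_in.
have {}out i : m \notin cell pi i by rewrite out.
by rewrite [X in cell_spec _ _ X]cell_reversal_out //; constructor.
Qed.

Lemma cell_reversalK n (pi : 'S_n) : involutive (cell_reversal pi).
Proof.
move=> m; case: (cell_reversalP pi m) => [i mi rmi | out].
  by rewrite (cell_reversal_in rmi) (cell_reversal_in mi) reversalK.
exact: cell_reversal_out.
Qed.

Lemma mem_cell_reversal n (pi : 'S_n) i m :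
  (cell_reversal pi m \in cell pi i) = (m \in cell pi i).
Proof.
case: (cell_reversalP pi m) => // j mj rmj.
by apply/idP/idP => [/(cell_inj rmj) | /(cell_inj mj)] <-.
Qed.

Lemma cell_reversal_corner n (pi : 'S_n) i m :
  m \in cell pi i -> cell_reversal pi i = i.
Proof. by move=> mi; apply: cell_reversal_out => j; apply: cell_corner mi. Qed.

Lemma cell_reversal_ltn n (pi : 'S_n) i m m' :
  m \in cell pi i -> m' \in cell pi i ->
  (cell_reversal pi m < cell_reversal pi m') = (m' < m).
Proof. by move=> mi m'i; rewrite !(@cell_reversal_in _ _ i) // reversal_ltn. Qed.

(** * The involution on permutations and its effect on cells *)

Definition reverse_cells n (pi : 'S_n) : 'S_n :=
  (perm (inv_inj (@cell_reversalK n pi)) * pi)%g.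

Lemma reverse_cellsE n (pi : 'S_n) m :
  reverse_cells pi m = pi (cell_reversal pi m).
Proof. by rewrite !permE /= permE. Qed.

Lemma cell_sub_reverse n (pi : 'S_n) i :
  cell pi i \subset cell (reverse_cells pi) i.
Proof.
apply/subsetP=> m mi; have := mi; rewrite -mem_cell_reversal.
case/cellP=> _ lt_pi left _; have [lt_im _ _ low] := cellP _ _ _ mi.
apply/cellP; rewrite !reverse_cellsE (cell_reversal_corner mi).
split=> // l; rewrite reverse_cellsE.
  (* A moved [l] is compared through the corner [c] of its cell, which is to the left of and below
     both [l] and its image. *)
  case: (cell_reversalP pi l) => [c lc rlc lt_li | _]; last exact: left.
  case/cellP: lc => lt_cl _ _ _; case/cellP: rlc => _ lt_c _ _.
  by apply: ltn_trans lt_c; apply: left; apply: ltn_trans lt_li.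
case: (cell_reversalP pi l) => [c lc rlc lt_li | _]; last exact: low.
case/cellP: lc => lt_cl _ _ _; case/cellP: rlc => _ lt_c _ _.
by apply: ltn_trans lt_cl; apply: low; apply: ltn_trans lt_li.
Qed.

(** Involutivity of [reverse_cells] rests on this equality, so the converse inclusion is proved
    directly, again by comparison through corners. *)
Lemma cell_reverse n (pi : 'S_n) i : cell (reverse_cells pi) i = cell pi i.
Proof.
apply/eqP; rewrite eqEsubset cell_sub_reverse andbT; apply/subsetP=> m mi.
have sub j k : k \in cell pi j -> k \in cell (reverse_cells pi) j.
  exact: (subsetP (cell_sub_reverse pi j)).
(* A corner of a nonempty new cell is in no new cell, hence by [sub] in no old one. *)
have fix_corner j k : k \in cell (reverse_cells pi) j -> cell_reversal pi j = j.
  move=> kj; apply: cell_reversal_out => c.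
  by apply: contra (@sub c j) (cell_corner c kj).
have mi' := mi; case/cellP: mi => lt_im.
rewrite !reverse_cellsE (fix_corner _ _ mi').
case: (cell_reversalP pi m) => [c /[dup] mc /sub /(cell_inj mi') -> // | out].
move=> lt_pi left low; apply/cellP; split=> // l.
  move: (left l); rewrite reverse_cellsE.
  case: (cell_reversalP pi l) => // c lc _ _ lt_li.
  case/cellP: (lc) => lt_cl lt_pi_cl _ _; have := left c (ltn_trans lt_cl lt_li).
  by rewrite reverse_cellsE (cell_reversal_corner lc) => /ltn_trans->.
move: (low l); rewrite reverse_cellsE.
case: (cell_reversalP pi l) => // c lc _ _ lt_li.
case/cellP: (lc) => lt_cl lt_pi_cl _ _; apply: ltn_trans lt_cl; apply: low.
by rewrite reverse_cellsE (cell_reversal_corner lc) (ltn_trans lt_pi_cl).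
Qed.

Lemma reverse_cellsK n : involutive (@reverse_cells n).
Proof.
move=> pi; apply/permP=> m; rewrite !reverse_cellsE.
have -> : cell_reversal (reverse_cells pi) m = cell_reversal pi m.
  rewrite /cell_reversal.
  under eq_pick do rewrite cell_reverse.
  by case: pickP => // i _; rewrite cell_reverse.
by rewrite cell_reversalK.
Qed.

(* On an occurrence [perm132] swaps the last two letters, and [cell_reversal]
   fixes the first one and exchanges the order of the other two. *)
Definition flip_occurrence n (pi : 'S_n) (f : {ffun 'I_3 -> 'I_n}) :=
  [ffun a => cell_reversal pi (f (perm132 a))].

Lemma flip_occurrence_inj n (pi : 'S_n) : injective (flip_occurrence pi).
Proof.
move=> f g /ffunP eq_fg; apply/ffunP=> a.
apply: (inv_inj (@cell_reversalK _ pi)).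
by have := eq_fg (perm132 a); rewrite !ffunE tpermK.
Qed.

Lemma is_occurrence_flip n (pi : 'S_n) f :
  is_occurrence (perm132, boxesR) (reverse_cells pi) (flip_occurrence pi f) =
  is_occurrence (perm123, boxesR) pi f.
Proof.
have p132 : (perm132 ord0 = ord0) * (perm132 (inord 1) = inord 2) *
    (perm132 (inord 2) = inord 1).
  by rewrite /perm132 tpermL tpermR tpermD // -val_eqE /= inordK.
rewrite !occurrence_cell ?perm1 ?p132 // !ffunE !p132 !cell_reverse !inordK //=.
rewrite !reverse_cellsE !cell_reversalK !mem_cell_reversal.
have corner m : m \in cell pi (cell_reversal pi (f ord0)) ->
    cell_reversal pi (f ord0) = f ord0.
  by move/cell_reversal_corner; rewrite cell_reversalK.
(* Values at distinct positions never tie, so swapping the two letters negates their comparison. *)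
have neq (m m' : 'I_n) : m < m' ->
    ((pi m' < pi m) == (2 < 1)) = ((pi m < pi m') == (1 < 2)).
  move=> lt_m; case: ltngtP => // /val_inj/perm_inj eq_m.
  by rewrite eq_m ltnn in lt_m.
apply/and4P/and4P => -[].
  move=> f2i f1i; have i_fix := corner _ f1i; rewrite i_fix in f1i f2i.
  by rewrite (cell_reversal_ltn f2i f1i) => lt_f; rewrite neq.
move=> f1i f2i lt_f lt_pi; rewrite (cell_reversal_corner f1i).
by rewrite (cell_reversal_ltn f2i f1i) lt_f f1i f2i neq.
Qed.

(** An injective self-map of a finite type is bijective, so taking preimages under [flip_occurrence]
    preserves cardinality. *)
Lemma num_occurrences_reverse_cells n (pi : 'S_n) :
  num_occurrences (perm132, boxesR) (reverse_cells pi) =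
  num_occurrences (perm123, boxesR) pi.
Proof.
rewrite /num_occurrences -(card_preimset _ (@flip_occurrence_inj _ pi)).
by apply: eq_card => f; rewrite !inE is_occurrence_flip.
Qed.

Theorem theorem3p1 :
  equidistributed (perm123, boxesR) (perm132, boxesR).
Proof.
move=> n l; rewrite -[RHS](card_preimset _ (inv_inj (@reverse_cellsK n))).
by apply: eq_card => pi; rewrite !inE num_occurrences_reverse_cells.
Qed.
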